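(* Let $(X,S,\tau)$ be a singular pair with $X$ finite, let $H$ be an abelian group and let $f,h:X\times X\to H$ be an abelian 2-cocycle pair. Then the partition function (state-sum) $$\Phi_{f,h}(L)=\sum_{\mathcal C\in Col_X(L)}\ \prod_{\gamma}B_{f,h}(\gamma,\mathcal C)\ \in\ \mathbb Z[H]$$ defines an invariant of oriented singular links, i.e. its value is the same for any two diagrams $L$ related by classical and singular oriented Reidemeister moves.
   Context: Notation: for $T:X\times X\to X\times X$ write $T(x,y)=(T^1(x,y),T^2(x,y))$. $T$ is left invertible if for any $x,z$ there is a unique $y$ with $T^1(x,y)=z$; right invertible if for any $y,w$ there is a unique $x$ with $T^2(x,y)=w$. A biquandle is a pair $(X,S)$, where $S:X\times X\to X\times X$ is a bijection, left and right invertible, satisfying $(\mathrm{Id}\times S)(S\times \mathrm{Id})(\mathrm{Id}\times S)=(S\times \mathrm{Id})(\mathrm{Id}\times S)(S\times \mathrm{Id})$, and such that there is a bijection $s:X\to X$ with $\{(x,y):S(x,y)=(x,y)\}=\{(x,s(x)):x\in X\}$. Given a biquandle $(X,S)$ and a bijective, left and right invertible $\tau:X\times X\to X\times X$, $(X,S,\tau)$ is a singular pair if $\tau\circ S=S\circ\tau$, $(S\times 1)(1\times S)(\tau\times 1)=(1\times \tau)(S\times 1)(1\times S)$ and $(1\times S)(S\times 1)(1\times \tau)=(\tau\times 1)(1\times S)(S\times 1)$. Singular links. A singular link diagram is a planar diagram of oriented closed curves with finitely many transversal double points, each either a classical crossing (positive or negative, with over/under information) or a singular crossing (the two strands meet transversally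 in a double point, with no over/under information). Singular links are equivalence classes of such diagrams under planar isotopy and the oriented Reidemeister moves: the classical moves RI, RII, RIII; RIVa (an arc is moved across a singular crossing, passing under both strands); RIVb (an arc is moved across a singular crossing, passing over both strands); and RV (for two strands both directed downwards, a positive classical crossing followed by a singular crossing is replaced by a singular crossing followed by a positive classical crossing). A semi-arc is a piece of the curve between two consecutive (classical or singular) crossing passages. Colorings. $Col_X(L)$ is the set of colorings of the diagram $L$ by $(X,S,\tau)$; a coloring $\mathcal C$ assigns an element of $X$ to each semi-arc such that, drawing each crossing with both strands directed downwards: - at a positive classical crossing (the strand from top left to bottom right passes under), if the top left and top right (incoming) semi-arcs have colors $x,y$, then the bottom left and bottom right (outgoing) ones have colors $S^1(x,y)$, $S^2(x,y)$; - at a negative classical crossing (the strand from top right to bottom left passes under), if the bottom left and bottom right (outgoing) semi-arcs have colors $x,y$, then the top left and top right (incoming) ones have colors $S^1(x,y)$, $S^2(x,y)$; - at a singular crossing, if the top left and top right (incoming) semi-arcs have colors $x,y$, then the bottom left and bottom right (outgoing) ones have colors $\tau^1(x,y)$, $\tau^2(x,y)$. Weights. With $x,y$ as in the three cases above, the Boltzmann weight $B_{f,h}(\gamma,\mathcal C)$ of the crossing $\gamma$ is $f(x,y)$ at a positive classical crossing, $f(x,y)^{-1}$ at a negative classical crossing, and $h(x,y)$ at a singular crossing. The product $\prod_\gamma$ runs over all (classical and singular) crossings of the diagram, each counted once. For an abelian group $H$ (written multiplicatively), maps $f,h:X\times X\to H$ form an abelian 2-cocycle pair if for all $x,y,z\in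 X$: (f1') $f(x,y)\,f(S^2(x,y),z)\,f(S^1(x,y),S^1(S^2(x,y),z))=f(x,S^1(y,z))\,f(S^2(x,S^1(y,z)),S^2(y,z))\,f(y,z)$; (f2') $f(x,s(x))=1$; (c1') $h(y,z)\,f(x,\tau^1(y,z))\,f(S^2(x,\tau^1(y,z)),\tau^2(y,z))=f(x,y)\,f(S^2(x,y),z)\,h(S^1(x,y),S^1(S^2(x,y),z))$; (c2') $f(y,z)\,f(x,S^1(y,z))\,h(S^2(x,S^1(y,z)),S^2(y,z))=h(x,y)\,f(\tau^2(x,y),z)\,f(\tau^1(x,y),S^1(\tau^2(x,y),z))$; (c3') $f(x,y)\,h(S(x,y))=h(x,y)\,f(\tau(x,y))$. $\mathbb Z[H]$ is the integral group ring of $H$. *)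

(* Defs.v *)
From HB Require Import structures.
From mathcomp Require Import all_boot all_algebra.
From mathcomp Require Import monalg.
From Stdlib Require Import Relation_Operators.

Set Implicit Arguments.
Unset Strict Implicit.
Unset Printing Implicit Defensive.

Import GRing.Theory.
Local Open Scope ring_scope.

(* ** Biquandles, singular pairs and cocycles                                 *)

Section Algebra.
Variable X : Type.
Implicit Types S T tau : X * X -> X * X.

Definition left_invertible T := forall x z, exists! y, (T (x, y)).1 = z.
Definition right_invertible T := forall y w, exists! x, (T (x, y)).2 = w.

(* T x Id and Id x T, on triples ((x, y), z) *)
Definition on12 T (t : X * X * X) : X * X * X := (T t.1, t.2).
Definition on23 T (t : X * X * X) : X * X * X :=
  let p := T (t.1.2, t.2) in (t.1.1, p.1, p.2).

Definition yang_baxter S :=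
  on23 S \o on12 S \o on23 S =1 on12 S \o on23 S \o on12 S.

Definition fixed_point_map S (s : X -> X) :=
  bijective s /\ forall x y, S (x, y) = (x, y) <-> y = s x.

Definition biquandle S :=
  [/\ bijective S, left_invertible S, right_invertible S, yang_baxter S
    & exists s, fixed_point_map S s].

Definition singular_pair S tau :=
  [/\ biquandle S, [/\ bijective tau, left_invertible tau & right_invertible tau],
      tau \o S =1 S \o tau,
      on12 S \o on23 S \o on12 tau =1 on23 tau \o on12 S \o on23 S
    & on23 S \o on12 S \o on23 tau =1 on12 tau \o on23 S \o on12 S].

(* The abelian group H is a zmodType, so its law is written additively. *)
Definition cocycle_pair (H : zmodType) S tau (s : X -> X) (f h : X * X -> H) :=
  let S1 x y := (S (x, y)).1 in let S2 x y := (S (x, y)).2 in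
  let t1 x y := (tau (x, y)).1 in let t2 x y := (tau (x, y)).2 in
  [/\ forall x y z,
        f (x, y) + f (S2 x y, z) + f (S1 x y, S1 (S2 x y) z)
        = f (x, S1 y z) + f (S2 x (S1 y z), S2 y z) + f (y, z),
      forall x, f (x, s x) = 0,
      forall x y z,
        h (y, z) + f (x, t1 y z) + f (S2 x (t1 y z), t2 y z)
        = f (x, y) + f (S2 x y, z) + h (S1 x y, S1 (S2 x y) z),
      forall x y z,
        f (y, z) + f (x, S1 y z) + h (S2 x (S1 y z), S2 y z)
        = h (x, y) + f (t2 x y, z) + f (t1 x y, S1 (t2 x y) z)
    & forall x y, f (x, y) + h (S (x, y)) = h (x, y) + f (tau (x, y))].

End Algebra.

(* ** Planar singular link diagrams                                           *)

(* A diagram is given by its planar diagram code: a finite set of semi-arcs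
   and, for every crossing drawn with both strands directed downwards, its kind
   and its four adjacent semi-arcs.  The drawing convention fixes the cyclic
   order of the semi-arcs around the crossing, hence a cell structure on an
   oriented closed surface, which is required below to be a union of spheres.
   A semi-arc adjacent to no crossing is a simple closed component. *)

Inductive xkind := Pos | Neg | Sing.

Definition nat_of_xkind k := match k with Pos => 0 | Neg => 1 | Sing => 2 end%N.
Lemma nat_of_xkind_inj : injective nat_of_xkind. Proof. by case; case. Qed.
HB.instance Definition _ := Equality.copy xkind (inj_type nat_of_xkind_inj).

(* (kind, (top left, top right), (bottom left, bottom right)) *)
Definition crossing (E : Type) := (xkind * (E * E) * (E * E))%type.

Definition map_crossing (E F : Type) (p : E -> F) (c : crossing E) : crossing F :=
  let: (k, (ul, ur), (dl, dr)) := c in (k, (p ul, p ur), (p dl, p dr)).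

Definition incoming E (c : crossing E) : seq E :=
  let: (_, (ul, ur), _) := c in [:: ul; ur].
Definition outgoing E (c : crossing E) : seq E :=
  let: (_, _, (dl, dr)) := c in [:: dl; dr].

Section Code.
Variable E : finType.
Implicit Type xs : seq (crossing E).

(* Every semi-arc either runs from exactly one crossing to exactly one crossing
   or is adjacent to no crossing. *)
Definition closed_code xs :=
  let ins := flatten (map (@incoming E) xs) in
  let outs := flatten (map (@outgoing E) xs) in
  [&& uniq ins, uniq outs & perm_eq ins outs].

Definition adjacent xs : rel E := fun e e' =>
  has (fun c => (e \in incoming c ++ outgoing c)
             && (e' \in incoming c ++ outgoing c)) xs.

(* (e, true) and (e, false) are the sides of e on the left and on the right hand
   of someone travelling along e; the four angular sectors of a crossing (top,
   bottom, and the ones on the left and on the right of the drawing) each lie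
   between two such sides. *)
Definition sectors (c : crossing E) : seq ((E * bool) * (E * bool)) :=
  let: (_, (ul, ur), (dl, dr)) := c in
  [:: ((ul, true), (ur, false)); ((dl, true), (dr, false));
      ((ul, false), (dl, false)); ((ur, true), (dr, true))].

Definition same_sector xs : rel (E * bool) := fun u v =>
  has (fun c => ((u, v) \in sectors c) || ((v, u) \in sectors c)) xs.

(* Genus 0 on each connected component: V - E + F = 2 #components, where
   V - E = - V since every crossing is 4-valent (a simple closed component
   has V - E = 0 and two faces). *)
Definition planar_code xs :=
  n_comp (same_sector xs) predT
    == (2 * n_comp (adjacent xs) predT + size xs)%N.

End Code.

Record diagram := Diagram {
  arc : finType;
  crossings : seq (crossing arc);
  crossings_closed : closed_code crossings;
  crossings_planar : planar_code crossings }.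

(* ** Oriented Reidemeister moves                                             *)

(* A piece of diagram with endpoints labelled by B *)
Record tangle (B : finType) := Tangle {
  tarc : finType;
  tcrossings : seq (crossing tarc);
  endpoint : B -> tarc }.

(* D is obtained by gluing the exterior K and the tangle T at their endpoints;
   the semi-arcs of D are the classes of the identification. *)
Definition glue_rel B (K T : tangle B) : rel (tarc K + tarc T) := fun u v =>
  [exists b, ((u == inl (endpoint K b)) && (v == inr (endpoint T b)))
          || ((v == inl (endpoint K b)) && (u == inr (endpoint T b)))].

Definition glued B (K T : tangle B) (D : diagram) :=
  exists p : tarc K + tarc T -> arc D,
    [/\ forall e, exists u, p u = e,
        forall u v, p u = p v <-> connect (glue_rel (K:=K) (T:=T)) u v
      & perm_eq (crossings D)
          (map (map_crossing (p \o inl)) (tcrossings K)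
           ++ map (map_crossing (p \o inr)) (tcrossings T))].

(* The tangles below consist of n strands, drawn in a disc with a reference
   direction; the endpoint (i, b) is the start (b = false) or the end (b = true)
   of strand i for this direction.  In [threads] every strand meets two crossing
   passages, (i, j) being its j-th semi-arc; in [straight] it meets none. *)
Definition straight n : tangle ('I_n * bool)%type :=
  @Tangle _ 'I_n [::] (fun b => b.1).

Definition threads n (xs : seq (crossing ('I_n * 'I_3))) :
    tangle ('I_n * bool)%type :=
  Tangle xs (fun b => (b.1, if b.2 then inord 2 else inord 0)).

Arguments straight : clear implicits.

Inductive level := FirstOver | SecondOver | Singular.

Definition swap_level v :=
  match v with FirstOver => SecondOver | SecondOver => FirstOver | v => v end.

(* The crossing of a strand running from p.1 to p.2 with a strand running from
   q.1 to q.2, where q crosses p from the right-hand side of p to its left-hand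
   side: when both are directed downwards, q goes from top left to bottom right. *)
Definition directed_cross E (v : level) (p q : E * E) : crossing E :=
  (match v with FirstOver => Pos | SecondOver => Neg | Singular => Sing end,
   (q.1, p.1), (p.2, q.2)).

(* The same for reference directions; a strand is travelled along its reference
   direction when its boolean is true and backwards otherwise.  Reversing one
   of the two strands exchanges their roles. *)
Definition cross E (v : level) (op : bool) (p : E * E) (oq : bool) (q : E * E) :=
  let orient o (a : E * E) := if o then a else (a.2, a.1) in
  if op == oq then directed_cross v (orient op p) (orient oq q)
  else directed_cross (swap_level v) (orient oq q) (orient op p).

(* the passage of strand i between its j-th and (j+1)-st semi-arcs *)
Definition pass n (i j : nat) : ('I_n.+1 * 'I_3) * ('I_n.+1 * 'I_3) :=
  ((inord i, inord j), (inord i, inord j.+1)).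

(* A strand crossing itself, the curl being on one or the other side of it *)
Definition curl (v : level) (side : bool) : tangle ('I_1 * bool)%type :=
  threads [:: if side then directed_cross v (pass 0 0 0) (pass 0 0 1)
              else directed_cross v (pass 0 0 1) (pass 0 0 0)].

(* Strands 0 (on the left) and 1 (on the right), with downward reference
   directions; strand 0 is pushed across strand 1 and back. *)
Definition clasp (v : level) (o0 o1 : bool) : tangle ('I_2 * bool)%type :=
  threads [:: cross (swap_level v) o1 (pass 1 1 0) o0 (pass 1 0 0);
              cross v o0 (pass 1 0 1) o1 (pass 1 1 1)].

(* Strands 0, 1, 2, from left to right at the top and from right to left at the
   bottom, with downward reference directions, any two of them crossing once;
   vij is the level of strand i relatively to strand j.  In [triangle_l] the
   crossings occur in the order 01, 02, 12 from top to bottom, and in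
   [triangle_r] in the order 12, 02, 01. *)
Definition triangle_l (v01 v02 v12 : level) (o0 o1 o2 : bool) :
    tangle ('I_3 * bool)%type :=
  threads [:: cross (swap_level v01) o1 (pass 2 1 0) o0 (pass 2 0 0);
              cross (swap_level v02) o2 (pass 2 2 0) o0 (pass 2 0 1);
              cross (swap_level v12) o2 (pass 2 2 1) o1 (pass 2 1 1)].

Definition triangle_r (v01 v02 v12 : level) (o0 o1 o2 : bool) :
    tangle ('I_3 * bool)%type :=
  threads [:: cross (swap_level v12) o2 (pass 2 2 0) o1 (pass 2 1 0);
              cross (swap_level v02) o2 (pass 2 2 1) o0 (pass 2 0 0);
              cross (swap_level v01) o1 (pass 2 1 1) o0 (pass 2 0 1)].

(* Two strands directed downwards, crossing with kind k, then with kind k';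
   strand 0 starts at the top left and ends at the bottom left. *)
Definition two_crossings (k k' : xkind) : tangle ('I_2 * bool)%type :=
  let a i j : 'I_2 * 'I_3 := (inord i, inord j) in
  threads [:: (k, (a 0 0, a 1 0), (a 1 1, a 0 1))%N;
              (k', (a 1 1, a 0 1), (a 0 2, a 1 2))%N].

(* FirstOver and SecondOver for the levels of a classical crossing *)
Definition classical (over : bool) := if over then FirstOver else SecondOver.

Inductive move : forall B : finType, tangle B -> tangle B -> Prop :=
| RI over side :
    move (straight 1) (curl (classical over) side)
| RII over o0 o1 :
    move (straight 2) (clasp (classical over) o0 o1)
(* some ordering of the three strands by height induces the three levels *)
| RIII b01 b02 b12 o0 o1 o2 :
    (b01 == b12) ==> (b02 == b01) ->
    move (triangle_l (classical b01) (classical b02) (classical b12) o0 o1 o2)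
         (triangle_r (classical b01) (classical b02) (classical b12) o0 o1 o2)
(* strand 2 is moved under (RIVa), resp. over (RIVb), the singular crossing of
   strands 0 and 1; every position of an arc next to a singular crossing is of
   this form up to a rotation of the picture *)
| RIVa o0 o1 o2 :
    move (triangle_l Singular FirstOver FirstOver o0 o1 o2)
         (triangle_r Singular FirstOver FirstOver o0 o1 o2)
| RIVb o0 o1 o2 :
    move (triangle_l Singular SecondOver SecondOver o0 o1 o2)
         (triangle_r Singular SecondOver SecondOver o0 o1 o2)
| RV :
    move (two_crossings Pos Sing) (two_crossings Sing Pos).

Definition isotopic (D D' : diagram) :=
  exists2 p : arc D -> arc D', bijective p
    & perm_eq (crossings D') (map (map_crossing p) (crossings D)).

Definition elementary (D D' : diagram) :=
  isotopic D D' \/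
  exists (B : finType) (K T T' : tangle B),
    [/\ move T T', glued K T D & glued K T' D'].

Definition singular_link_equiv : diagram -> diagram -> Prop :=
  clos_refl_sym_trans diagram elementary.

(* ** Colorings and the state-sum                                             *)

Section StateSum.
Variables (X : finType) (S tau : X * X -> X * X).
Variables (H : zmodType) (f h : X * X -> H).
Variable D : diagram.
Implicit Type c : {ffun arc D -> X}.

Definition colored_at c (x : crossing (arc D)) : bool :=
  let: (k, (ul, ur), (dl, dr)) := x in
  match k with
  | Pos => (c dl, c dr) == S (c ul, c ur)
  | Neg => (c ul, c ur) == S (c dl, c dr)
  | Sing => (c dl, c dr) == tau (c ul, c ur)
  end.

Definition coloring c : bool := all (colored_at c) (crossings D).

Definition boltzmann c (x : crossing (arc D)) : H :=
  let: (k, (ul, ur), (dl, dr)) := x in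
  match k with
  | Pos => f (c ul, c ur)
  | Neg => - f (c dl, c dr)
  | Sing => h (c ul, c ur)
  end.

(* {malg int[H]} is the free abelian group on H, i.e. the additive group of the
   group ring Z[H], and << g >> is the basis element attached to g. *)
Definition state_sum : {malg int[H]} :=
  \sum_(c : {ffun arc D -> X} | coloring c)
     << \sum_(x <- crossings D) boltzmann c x >>.

End StateSum.

(* Main.v *)
From mathcomp Require Import all_boot all_algebra.
From mathcomp Require Import monalg.
Require Import Defs.

Set Implicit Arguments.
Unset Strict Implicit.
Unset Printing Implicit Defensive.

Import GRing.Theory.
Local Open Scope ring_scope.

(** The state-sum is computed locally.  A coloring of a diagram glued from an
    exterior [K] and a tangle [T] is a coloring of [K] together with a coloring
    of [T] agreeing with it at the endpoints, and the weights add up; hence the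
    state-sum is a sum, over the colorings of [K], of state-sums of [T] with
    prescribed endpoint colors ([state_sum_glued]).  It remains to see that the
    two sides of a move have the same local state-sums.

    In all the tangles occurring in the moves, the endpoint colors determine the
    coloring ([rigid]).  So a local state-sum is either [0] or a single group
    element, and it is enough that every coloring of one side has a counterpart
    on the other side with the same endpoint colors and the same total weight
    ([transfers], [local_sum_eq]).

    Rigidity, and the moves RI and RII in all orientations, come from one fact:
    the four colors around a crossing are determined by the two colors on any
    one of its four sectors ([square_corner], [cross_corner]), and these two can
    be arbitrary ([cross_fill]).  For the top and bottom sectors this is
    bijectivity, for the two lateral ones it is left and right invertibility.
    RI compares in addition with the squares of the fixed points of [S], and RV is
    the commutation of [S] and [tau].

    For RIII and RIV, the nine colors on one side of the move and the three new
    ones on the other side label the twelve edges of a cube whose six faces are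
    the crossings, opposite faces being the same crossing before and after the
    move.  The triangular region of one side of the move is a vertex of the
    cube, whose three faces are the crossings of that side, and the other side
    of the move lies around the opposite vertex.  The Yang-Baxter type equations
    say that three faces around the vertex 010 extend to a whole cube, and the
    cocycle equations say that the weights of the six faces balance.  Because a
    face is determined by any of its corners, the same then holds around each of
    the eight vertices ([cube_000], ..., [cube_111]), and the eight vertices
    account for all the orientations of the strands and all the levels. *)

(** * State-sums of glued diagrams *)

Section Gluing.
Variables (X : finType) (S tau : X * X -> X * X).
Variables (H : zmodType) (f h : X * X -> H).

(** [colored_at] and [boltzmann] for arcs that need not be those of a closed
    diagram. *)
Definition legal E (c : E -> X) (x : crossing E) : bool :=
  let: (k, (ul, ur), (dl, dr)) := x in
  match k with
  | Pos => (c dl, c dr) == S (c ul, c ur)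
  | Neg => (c ul, c ur) == S (c dl, c dr)
  | Sing => (c dl, c dr) == tau (c ul, c ur)
  end.

Definition weight E (c : E -> X) (x : crossing E) : H :=
  let: (k, (ul, ur), (dl, dr)) := x in
  match k with
  | Pos => f (c ul, c ur)
  | Neg => - f (c dl, c dr)
  | Sing => h (c ul, c ur)
  end.

Definition proper E (c : E -> X) xs := all (legal c) xs.
Definition total E (c : E -> X) (xs : seq (crossing E)) : H :=
  \sum_(x <- xs) weight c x.

Lemma state_sumE D : state_sum S tau f h D =
  \sum_(c : {ffun arc D -> X} | proper c (crossings D))
     << total c (crossings D) >>.
Proof. by []. Qed.

Lemma proper_map E F (p : E -> F) (c : F -> X) xs :
  proper c (map (map_crossing p) xs) = proper (c \o p) xs.
Proof.
by rewrite /proper all_map; apply: eq_all => -[[k [? ?]] [? ?]].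
Qed.

Lemma total_map E F (p : E -> F) (c : F -> X) xs :
  total c (map (map_crossing p) xs) = total (c \o p) xs.
Proof.
by rewrite /total big_map; apply: eq_bigr => -[[k [? ?]] [? ?]] _.
Qed.

Lemma eq_proper E (c d : E -> X) xs : c =1 d -> proper c xs = proper d xs.
Proof.
by move=> cd; apply: eq_all => -[[k [? ?]] [? ?]]; rewrite /= !cd.
Qed.

Lemma eq_total E (c d : E -> X) xs : c =1 d -> total c xs = total d xs.
Proof.
by move=> cd; apply: eq_bigr => -[[k [? ?]] [? ?]] _; rewrite /= !cd.
Qed.

Lemma proper_perm (E : eqType) (c : E -> X) xs ys :
  perm_eq xs ys -> proper c xs = proper c ys.
Proof. by move=> xy; apply: perm_all. Qed.

Lemma total_perm (E : eqType) (c : E -> X) (xs ys : seq (crossing E)) :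
  perm_eq xs ys -> total c xs = total c ys.
Proof. by move=> xy; apply: perm_big. Qed.

Lemma state_sum_isotopic D D' :
  isotopic D D' -> state_sum S tau f h D = state_sum S tau f h D'.
Proof.
case=> p [q pK qK] cr; rewrite !state_sumE.
pose push (c : {ffun arc D -> X}) : {ffun arc D' -> X} := [ffun e => c (q e)].
pose pull (c : {ffun arc D' -> X}) : {ffun arc D -> X} := [ffun e => c (p e)].
have pushK : cancel push pull by move=> c; apply/ffunP=> e; rewrite !ffunE pK.
have pullK : cancel pull push by move=> c; apply/ffunP=> e; rewrite !ffunE qK.
rewrite [RHS](reindex push); last by exists pull => c _.
have cE c : push c \o p =1 c by move=> e; rewrite /= ffunE pK.
apply: eq_big => [c | c _].
  by rewrite (proper_perm _ cr) proper_map (eq_proper _ (cE c)).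
by rewrite (total_perm _ cr) total_map (eq_total _ (cE c)).
Qed.

Section Tangles.
Variable B : finType.
Implicit Types K T : tangle B.

Definition local_sum T (eta : B -> X) (g : H) : {malg int[H]} :=
  \sum_(b : {ffun tarc T -> X}
          | proper b (tcrossings T) && [forall i, eta i == b (endpoint T i)])
     << g + total b (tcrossings T) >>.

(** The arcs of [D] being the classes of the identification, a map out of
    [arc D] is a pair of maps, out of the arcs of [K] and of [T], that agree at
    the endpoints. *)
Lemma state_sum_glued K T D : glued K T D ->
  state_sum S tau f h D =
  \sum_(a : {ffun tarc K -> X} | proper a (tcrossings K))
     local_sum T (a \o endpoint K) (total a (tcrossings K)).
Proof.
case=> p [p_surj p_eq cr].
have p_rep e : exists u, p u == e by have [u <-] := p_surj e; exists u.
pose rep e := xchoose (p_rep e).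
have repK e : p (rep e) = e by apply/eqP; exact: xchooseP (p_rep e).
pose join (ab : {ffun tarc K -> X} * {ffun tarc T -> X}) u :=
  match u with inl e => ab.1 e | inr e => ab.2 e end.
pose agree ab := [forall i,
  join ab (inl (endpoint K i)) == join ab (inr (endpoint T i))].
pose restrict (c : {ffun arc D -> X}) :
    {ffun tarc K -> X} * {ffun tarc T -> X} :=
  ([ffun e => c (p (inl e))], [ffun e => c (p (inr e))]).
pose extend ab : {ffun arc D -> X} := [ffun e => join ab (rep e)].
have joinP ab u v : agree ab -> connect (glue_rel (K:=K) (T:=T)) u v ->
    join ab u = join ab v.
  move=> /forallP ab_agree /connectP[w uw ->]; elim: w u uw => //= v' w IHw u.
  case/andP=> /existsP[i /orP[]/andP[/eqP uE /eqP vE]] /IHw <-.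
    by rewrite uE vE; apply/eqP/ab_agree.
  by rewrite uE vE; apply/esym/eqP/ab_agree.
have extendK ab : agree ab -> restrict (extend ab) = ab.
  move=> ab_agree; case: ab ab_agree => a b ab_agree; congr (_, _).
    by apply/ffunP=> e; rewrite !ffunE (joinP _ _ (inl e)) //; apply/p_eq.
  by apply/ffunP=> e; rewrite !ffunE (joinP _ _ (inr e)) //; apply/p_eq.
have restrictK : cancel restrict extend.
  move=> c; apply/ffunP=> e; rewrite ffunE -{2}(repK e) /join.
  by case: (rep e) => u; rewrite ffunE.
have glue_p i : p (inl (endpoint K i)) = p (inr (endpoint T i)).
  by apply/p_eq/connect1/existsP; exists i; rewrite !eqxx.
rewrite pair_big_dep /= state_sumE.
rewrite (reindex_onto extend restrict) => [|c _]; last exact: restrictK.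
have eqK a b : agree (a, b) -> extend (a, b) \o (p \o inl) =1 a.
  by move=> /extendK/(congr1 fst)/ffunP/= abE e; rewrite -abE [RHS]ffunE.
have eqT a b : agree (a, b) -> extend (a, b) \o (p \o inr) =1 b.
  by move=> /extendK/(congr1 snd)/ffunP/= abE e; rewrite -abE [RHS]ffunE.
have agreeE ab : (restrict (extend ab) == ab) = agree ab.
  apply/eqP/idP=> [<-|]; last exact: extendK.
  by apply/forallP=> i; rewrite /= !ffunE glue_p.
apply: eq_big => [[a b]|[a b]]; rewrite agreeE.
  case: (boolP (agree (a, b))) => ab_agree; last first.
    by rewrite andbF /= [X in _ && (_ && X)](negbTE ab_agree) !andbF.
  rewrite (proper_perm _ cr) /proper all_cat -!/(proper _ _) !proper_map.
  rewrite (eq_proper _ (eqK a b _)) // (eq_proper _ (eqT a b _)) //.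
  by rewrite [X in _ && (_ && X)]ab_agree !andbT.
case/andP=> _ ab_agree.
rewrite (total_perm _ cr) /total big_cat -!/(total _ _) !total_map.
by rewrite (eq_total _ (eqK a b _)) // (eq_total _ (eqT a b _)).
Qed.

Definition rigid T := forall b b' : tarc T -> X,
  proper b (tcrossings T) -> proper b' (tcrossings T) ->
  b \o endpoint T =1 b' \o endpoint T -> b =1 b'.

Definition transfers T T' := forall b : tarc T -> X,
  proper b (tcrossings T) ->
  exists2 b' : tarc T' -> X, b \o endpoint T =1 b' \o endpoint T'
    & proper b' (tcrossings T')
      /\ total b (tcrossings T) = total b' (tcrossings T').

Lemma local_sum_single T eta g (b : tarc T -> X) :
  rigid T -> proper b (tcrossings T) -> eta =1 b \o endpoint T ->
  local_sum T eta g = << g + total b (tcrossings T) >>.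
Proof.
move=> rT bP eta_b; have bE : [ffun e => b e] =1 b by move=> e; rewrite ffunE.
rewrite /local_sum (big_pred1 [ffun e => b e]) => [|b' /=].
  by rewrite (eq_total _ bE).
apply/andP/eqP=> [[b'P /forallP eta_b'] | ->].
  apply/ffunP=> e; rewrite ffunE; apply: rT => // i.
  by rewrite -eta_b /= (eqP (eta_b' i)).
split; first by rewrite (eq_proper _ bE).
by apply/forallP=> i; rewrite eta_b ffunE.
Qed.

(** Both local state-sums are zero, or both have exactly one term. *)
Lemma local_sum_eq T T' : rigid T -> rigid T' ->
  transfers T T' -> transfers T' T -> local_sum T =2 local_sum T'.
Proof.
have aux U U' eta g (b : {ffun tarc U -> X}) : rigid U -> rigid U' ->
    transfers U U' ->
    proper b (tcrossings U) && [forall i, eta i == b (endpoint U i)] ->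
    local_sum U eta g = local_sum U' eta g.
  move=> rU rU' tr /andP[bP /forallP eta_b].
  have [b' bb' [b'P wE]] := tr b bP.
  have etaE : eta =1 b \o endpoint U by move=> i; rewrite /= (eqP (eta_b i)).
  rewrite (local_sum_single g rU bP etaE) wE.
  by rewrite (local_sum_single g rU' b'P) // => i; rewrite etaE bb'.
move=> rT rT' trT trT' eta g.
set PT := fun b : {ffun tarc T -> X} =>
  proper b (tcrossings T) && [forall i, eta i == b (endpoint T i)].
set PT' := fun b : {ffun tarc T' -> X} =>
  proper b (tcrossings T') && [forall i, eta i == b (endpoint T' i)].
case: (pickP PT) => [b | noT]; first exact: aux.
case: (pickP PT') => [b bP | noT']; first by rewrite (aux T' T eta g b).
by rewrite /local_sum !big_pred0.
Qed.

End Tangles.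
End Gluing.

(** * Squares *)

Section Squares.
Variable X : Type.
Implicit Types A B C T : X * X -> X * X.

(** [T (x, y) = (p, q)] is seen as a square whose edges form two paths [x, y]
    and [p, q] between the same two vertices; its corners are then [(x, y)],
    [(p, q)], [(x, p)] and [(y, q)], and each of them determines the square. *)
Definition square_map T :=
  [/\ bijective T, left_invertible T & right_invertible T].

Lemma square_out T p q : square_map T -> exists x y, T (x, y) = (p, q).
Proof.
by case=> -[T' _ T'K] _ _; case: (T' (p, q)) (T'K (p, q)) => x y; exists x, y.
Qed.

Lemma square_left T x p : square_map T -> exists y q, T (x, y) = (p, q).
Proof.
case=> _ /(_ x p)[y [Txy _]] _; exists y, (T (x, y)).2.
by rewrite -Txy -surjective_pairing.
Qed.

Lemma square_right T y q : square_map T -> exists x p, T (x, y) = (p, q).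
Proof.
case=> _ _ /(_ y q)[x [Txy _]]; exists x, (T (x, y)).1.
by rewrite -Txy -surjective_pairing.
Qed.

Lemma square_corner T x y p q x' y' p' q' : square_map T ->
  T (x, y) = (p, q) -> T (x', y') = (p', q') ->
  [\/ x = x' /\ y = y', p = p' /\ q = q', x = x' /\ p = p'
    | y = y' /\ q = q'] ->
  [/\ x = x', y = y', p = p' & q = q'].
Proof.
move=> [bijT leftT rightT] E E'.
suff: x = x' /\ y = y' -> [/\ x = x', y = y', p = p' & q = q'].
  move=> reduce [] // [e1 e2].
  - apply: reduce; have: T (x, y) = T (x', y') by rewrite E E' e1 e2.
    by move/(bij_inj bijT)=> [].
  - apply: reduce; split=> //; have [y0 [_ uniq_y]] := leftT x p.
    by rewrite -(uniq_y y) ?E // (uniq_y y') // e1 e2 E'.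
  - apply: reduce; split=> //; have [x0 [_ uniq_x]] := rightT y q.
    by rewrite -(uniq_x x) ?E // (uniq_x x') // e1 e2 E'.
by case=> e1 e2; move: E; rewrite e1 e2 E' => -[-> ->].
Qed.

End Squares.

(** * Cubes *)

Lemma diff3 (H : zmodType) (a b c a' b' c' : H) :
  (a - a') + (b - b') + (c - c') = a + b + c - (c' + b' + a').
Proof.
rewrite (addrACA a) (addrACA (a + b)) -!opprD.
by rewrite (addrC _ c') (addrC a') addrA.
Qed.

Section Cubes.
Variables (X : Type) (H : zmodType).
Variables (A B C : X * X -> X * X) (wA wB wC : X * X -> H).

(** The move replaces the path [x, y, z] by [a, b, c] across the three faces
    [A], [B], [C] in two ways; [wA], [wB], [wC] weigh the faces.  Three maps are
    needed because two opposite faces may be singular crossings. *)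
Definition cube_rule :=
  [/\ square_map A, square_map B, square_map C,
      on12 C \o on23 B \o on12 A =1 on23 A \o on12 B \o on23 C
    & forall x y z,
        wA (x, y) + wB ((A (x, y)).2, z)
          + wC ((A (x, y)).1, (B ((A (x, y)).2, z)).1)
        = wC (y, z) + wB (x, (C (y, z)).1)
          + wA ((B (x, (C (y, z)).1)).2, (C (y, z)).2)].

(** The weights of the faces around 010 and around 101 have equal sums.
    Grouping opposite faces makes this usable around every other vertex:
    exchanging two opposite faces only changes the sign of their difference. *)
Definition balanced x y z p q r u v w : Prop :=
  (wA (x, y) - wA (w, v)) + (wB (q, z) - wB (x, u))
  + (wC (p, r) - wC (y, z)) = 0.

(** The edges, named by their ends in [{0, 1}^3]:
      x 000-100   y 100-110   z 110-111
      p 000-010   q 010-110   r 010-011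
      a 000-001   b 001-011   c 011-111
      u 100-101   v 101-111   w 001-101 *)
Definition cube x y z p q r a b c u v w : Prop :=
  [/\ A (x, y) = (p, q) /\ A (w, v) = (b, c),
      B (q, z) = (r, c) /\ B (x, u) = (a, w),
      C (p, r) = (a, b) /\ C (y, z) = (u, v)
    & balanced x y z p q r u v w].

Hypothesis ABC : cube_rule.

(** This is the Yang-Baxter type equation itself. *)
Lemma cube_010 x y z p q r a b c :
  A (x, y) = (p, q) -> B (q, z) = (r, c) -> C (p, r) = (a, b) ->
  exists u v w, cube x y z p q r a b c u v w.
Proof.
case: ABC => _ _ _ /(_ (x, y, z)) + /(_ x y z).
rewrite /on12 /on23 /= => + + EA EB EC; rewrite EA /= EB /= EC /=.
case EC': (C _) => [u v] /=; case EB': (B _) => [a' w] /=.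
case EA': (A _) => [b' c'] /= [? ? ?] bal; subst; exists u, v, w; split=> //.
by rewrite /balanced diff3 bal subrr.
Qed.

(** The three faces around 101 contain the path [x, y, z], from which the whole
    cube around 010 can be recomputed. *)
Lemma cube_101 x y z u v w a b c :
  C (y, z) = (u, v) -> B (x, u) = (a, w) -> A (w, v) = (b, c) ->
  exists p q r, cube x y z p q r a b c u v w.
Proof.
move=> EC' EB' EA'.
case EA: (A (x, y)) => [p q]; case EB: (B (q, z)) => [r c'].
case EC: (C (p, r)) => [a' b'].
have [u' [v' [w' cub]]] := cube_010 EA EB EC.
case: (cub) => -[_ EA''] [_ EB''] [_ EC''] _.
move: EC''; rewrite EC' => -[? ?]; subst.
move: EB''; rewrite EB' => -[? ?]; subst.
by move: EA''; rewrite EA' => -[? ?]; subst; exists p, q, r.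
Qed.

(** identifies two squares [E] and [E'] that have a corner in common *)
Ltac corner sq E E' :=
  let e := fresh in have e := square_corner sq E E';
  case: e; [by [constructor 1 | constructor 2 | constructor 3 | constructor 4]
           | intros; subst].

(** The vertices 000, 110 and 011 are adjacent to 010: the two given faces that
    meet along the connecting edge already contain all three edges at 010.  The
    remaining face at 010 is filled in, [cube_010] is applied, and the third
    given face is recognized in the result by one of its corners. *)
Lemma cube_000 x y p q r a b u w :
  A (x, y) = (p, q) -> C (p, r) = (a, b) -> B (x, u) = (a, w) ->
  exists z c v, cube x y z p q r a b c u v w.
Proof.
case: (ABC) => sA sB sC _ _ EA EC EB'.
have [z [c EB]] := square_left q r sB.
have [u' [v [w' cub]]] := cube_010 EA EB EC; case: (cub) => _ [_ E] _ _.
by corner sB EB' E; exists z, c, v.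
Qed.

Lemma cube_110 x y z p q r c u v :
  A (x, y) = (p, q) -> B (q, z) = (r, c) -> C (y, z) = (u, v) ->
  exists a b w, cube x y z p q r a b c u v w.
Proof.
case: (ABC) => sA sB sC _ _ EA EB EC'.
case EC: (C (p, r)) => [a b].
have [u' [v' [w cub]]] := cube_010 EA EB EC; case: (cub) => _ _ [_ E] _.
by corner sC EC' E; exists a, b, w.
Qed.

Lemma cube_011 z p q r a b c v w :
  B (q, z) = (r, c) -> C (p, r) = (a, b) -> A (w, v) = (b, c) ->
  exists x y u, cube x y z p q r a b c u v w.
Proof.
case: (ABC) => sA sB sC _ _ EB EC EA'.
have [x [y EA]] := square_out p q sA.
have [u [v' [w' cub]]] := cube_010 EA EB EC; case: (cub) => -[_ E] _ _ _.
by corner sA EA' E; exists x, y, u.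
Qed.

(** The vertices 100, 111 and 001 are adjacent to 101 and treated in the same
    way, with [cube_101] instead of [cube_010]. *)
Lemma cube_100 x y z p q a u v w :
  A (x, y) = (p, q) -> C (y, z) = (u, v) -> B (x, u) = (a, w) ->
  exists r b c, cube x y z p q r a b c u v w.
Proof.
case: (ABC) => sA sB sC _ _ EA EC' EB'.
case EA': (A (w, v)) => [b c].
have [p' [q' [r cub]]] := cube_101 EC' EB' EA'; case: (cub) => -[E _] _ _ _.
by corner sA EA E; exists r, b, c.
Qed.

Lemma cube_111 y z q r b c u v w :
  B (q, z) = (r, c) -> C (y, z) = (u, v) -> A (w, v) = (b, c) ->
  exists x p a, cube x y z p q r a b c u v w.
Proof.
case: (ABC) => sA sB sC _ _ EB EC' EA'.
have [x [a EB']] := square_right u w sB.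
have [p [q' [r' cub]]] := cube_101 EC' EB' EA'; case: (cub) => _ [E _] _ _.
by corner sB EB E; exists x, p, a.
Qed.

Lemma cube_001 x p r a b c u v w :
  C (p, r) = (a, b) -> B (x, u) = (a, w) -> A (w, v) = (b, c) ->
  exists y z q, cube x y z p q r a b c u v w.
Proof.
case: (ABC) => sA sB sC _ _ EC EB' EA'.
have [y [z EC']] := square_out u v sC.
have [p' [q [r' cub]]] := cube_101 EC' EB' EA'; case: (cub) => _ _ [E _] _.
by corner sC EC E; exists y, z, q.
Qed.

End Cubes.

(** * Colorings of tangles made of strands *)

Section Threads.
Variables (X : finType) (S tau : X * X -> X * X).
Variables (H : zmodType) (f h : X * X -> H).
Notation proper := (proper S tau).
Notation total := (total f h).
Variable n : nat.
Implicit Types xs ys : seq (crossing ('I_n.+1 * 'I_3)).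
Implicit Types b : 'I_n.+1 * 'I_3 -> X.

(** The middle colors are listed, in the order of the strands, so that they can
    be given explicitly even when [X] has no distinguished element. *)
Definition recolor b (m : seq X) (e : 'I_n.+1 * 'I_3) :=
  if e.2 == inord 1 then nth (b e) m e.1 else b e.

Lemma recolor_start b m i :
  recolor b m (inord i, inord 0) = b (inord i, inord 0).
Proof. by rewrite /recolor ifN //= -val_eqE /= !inordK. Qed.

Lemma recolor_end b m i :
  recolor b m (inord i, inord 2) = b (inord i, inord 2).
Proof. by rewrite /recolor ifN //= -val_eqE /= !inordK. Qed.

Lemma recolor_mid b m i : (i < n.+1)%N ->
  recolor b m (inord i, inord 1) = nth (b (inord i, inord 1)) m i.
Proof. by move=> i_n; rewrite /recolor /= eqxx inordK. Qed.

Lemma threads_transfers xs ys :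
  (forall b, proper b xs -> exists m,
     proper (recolor b m) ys /\ total b xs = total (recolor b m) ys) ->
  transfers S tau f h (threads xs) (threads ys).
Proof.
move=> xy b /xy[m []]; exists (recolor b m) => //= -[i [] /=].
  by rewrite -(inord_val i) recolor_end.
by rewrite -(inord_val i) recolor_start.
Qed.

Lemma threads_rigid xs :
  (forall b b', proper b xs -> proper b' xs ->
     (forall i, b (inord i, inord 0) = b' (inord i, inord 0)) ->
     (forall i, b (inord i, inord 2) = b' (inord i, inord 2)) ->
     forall i, (i < n.+1)%N -> b (inord i, inord 1) = b' (inord i, inord 1)) ->
  rigid S tau (threads xs).
Proof.
move=> xs_rigid b b' bP b'P bb'.
have bb0 i : b (inord i, inord 0) = b' (inord i, inord 0).
  exact: (bb' (inord i, false)).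
have bb2 i : b (inord i, inord 2) = b' (inord i, inord 2).
  exact: (bb' (inord i, true)).
case=> i j; rewrite -(inord_val i) -(inord_val j).
by case: j => -[|[|[|//]]] _ //=; apply: xs_rigid.
Qed.

End Threads.

(** * Passing a strand across a crossing *)

(** The crossings of [triangle_l] and [triangle_r] are listed in opposite
    orders, which is why [l1] is paired with [r3]. *)
Lemma sum3_eq (H : zmodType) (l1 l2 l3 r1 r2 r3 : H) :
  (l1 - r3) + (l2 - r2) + (l3 - r1) = 0 ->
  l1 + (l2 + (l3 + 0)) = r1 + (r2 + (r3 + 0)).
Proof. by rewrite diff3 => /eqP; rewrite subr_eq0 !addr0 !addrA => /eqP. Qed.

Lemma diff3_flip (H : zmodType) (a b c a' b' c' : H) :
  (a - a') + (b - b') + (c - c') = 0 -> (a' - a) + (b' - b) + (c' - c) = 0.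
Proof. by move/(congr1 -%R); rewrite oppr0 !opprD !opprK ![- _ + _]addrC. Qed.

(** The form in which a negative crossing contributes to [balanced]. *)
Lemma subNN (H : zmodType) (a b : H) : - a - - b = b - a.
Proof. by rewrite opprK addrC. Qed.

(** closes a goal that is [bal] up to the order of its three terms *)
Ltac use_balance bal :=
  first [ exact: bal | by rewrite addrAC
        | by rewrite addrC addrA | by rewrite addrC addrA addrAC
        | by rewrite addrAC addrC addrA | by rewrite -addrA addrC ].

(** finds the vertex of the cube around which the three crossings in the context
    lie, and completes the cube *)
Ltac fill R bal :=
  let cub := fresh in
  match goal with E1 : _ = (_, _), E2 : _ = (_, _), E3 : _ = (_, _) |- _ =>
    first [ destruct (cube_000 R E1 E2 E3) as (? & ? & ? & cub)
          | destruct (cube_001 R E1 E2 E3) as (? & ? & ? & cub)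
          | destruct (cube_010 R E1 E2 E3) as (? & ? & ? & cub)
          | destruct (cube_011 R E1 E2 E3) as (? & ? & ? & cub)
          | destruct (cube_100 R E1 E2 E3) as (? & ? & ? & cub)
          | destruct (cube_101 R E1 E2 E3) as (? & ? & ? & cub)
          | destruct (cube_110 R E1 E2 E3) as (? & ? & ? & cub)
          | destruct (cube_111 R E1 E2 E3) as (? & ? & ? & cub) ];
    destruct cub as [[? ?] [? ?] [? ?] bal]
  end.

Ltac face :=
  apply/eqP; multimatch goal with E : _ = (_, _) |- _ => exact (esym E) end.

(** colors the other side of the move by the opposite three faces of the cube *)
Ltac move_over R :=
  let bal := fresh in
  fill R bal; eexists [:: _; _; _];
  rewrite /total !big_cons !big_nil /=;
  rewrite !(recolor_start, recolor_end, recolor_mid) //=;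
  split;
  [ apply/and4P; split; [face | face | face | done]
  | apply: sum3_eq; rewrite ?subNN;
    first [ use_balance bal
          | let flip := fresh in
            have flip := diff3_flip bal; use_balance flip ] ].

Ltac triangle_transfers :=
  apply: threads_transfers => b; rewrite /proper /=;
  case/and4P=> /eqP/esym E1 /eqP/esym E2 /eqP/esym E3 _.

Section Moves.
Variables (X : finType) (S tau : X * X -> X * X) (s : X -> X).
Variables (H : zmodType) (f h : X * X -> H).
Hypothesis sing : singular_pair S tau.
Hypothesis fix_s : fixed_point_map S s.
Hypothesis coc : cocycle_pair S tau s f h.

Let sqS : square_map S. Proof. by case: sing => -[]. Qed.
Let sqT : square_map tau. Proof. by case: sing. Qed.

Lemma cube_SSS : cube_rule S S S f f f.
Proof.
case: sing coc => -[_ _ _ YB _] _ _ _ _ [f1 _ _ _ _].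
by split=> // x y z; rewrite f1 addrC addrA.
Qed.

Lemma cube_TSS : cube_rule tau S S h f f.
Proof.
case: sing coc => _ _ _ YB _ [_ _ _ c2 _].
by split=> // x y z; rewrite -c2.
Qed.

Lemma cube_SST : cube_rule S S tau f f h.
Proof.
case: sing coc => _ _ _ _ YB [_ _ c1 _ _].
by split=> // x y z; rewrite -c1 addrC addrA.
Qed.

Lemma RIII_transfers b01 b02 b12 o0 o1 o2 :
  (b01 == b12) ==> (b02 == b01) ->
  let: (v01, v02, v12) := (classical b01, classical b02, classical b12) in
  let l := triangle_l v01 v02 v12 o0 o1 o2 in
  let r := triangle_r v01 v02 v12 o0 o1 o2 in
  transfers S tau f h l r /\ transfers S tau f h r l.
Proof.
have R := cube_SSS.
by case: b01 b02 b12 o0 o1 o2 => [] [] [] [] [] [] // _; split;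
  triangle_transfers; move_over R.
Qed.

Lemma RIV_transfers over o0 o1 o2 :
  let l := triangle_l Singular (classical over) (classical over) o0 o1 o2 in
  let r := triangle_r Singular (classical over) (classical over) o0 o1 o2 in
  transfers S tau f h l r /\ transfers S tau f h r l.
Proof.
have [R R'] := (cube_TSS, cube_SST).
by case: over o0 o1 o2 => [] [] [] []; split; triangle_transfers;
  first [move_over R | move_over R'].
Qed.

(** * Rigidity *)

(** The sectors of a crossing are the corners of the corresponding square,
    whatever the kind of the crossing and the directions of its strands. *)
Lemma cross_corner v op oq E E' (c : E -> X) (c' : E' -> X) p q p' q' :
  legal S tau c (cross v op p oq q) -> legal S tau c' (cross v op p' oq q') ->
  c p.1 = c' p'.1 \/ c p.2 = c' p'.2 -> c q.1 = c' q'.1 \/ c q.2 = c' q'.2 ->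
  [/\ c p.1 = c' p'.1, c p.2 = c' p'.2, c q.1 = c' q'.1 & c q.2 = c' q'.2].
Proof.
by case: v op oq => [] [] [] /eqP/esym U /eqP/esym V [] ? [] ?;
  first [case: (square_corner sqS U V) | case: (square_corner sqT U V)];
  by [ | constructor 1 | constructor 2 | constructor 3 | constructor 4].
Qed.

(** The first crossing, whose two starting arcs are endpoints, gives the middle
    colors of two strands; the last one, whose two final arcs are endpoints,
    gives the third. *)
Lemma triangle_l_rigid v01 v02 v12 o0 o1 o2 :
  rigid S tau (triangle_l v01 v02 v12 o0 o1 o2).
Proof.
apply: threads_rigid => b b' /and4P[b1 _ b3 _] /and4P[b1' _ b3' _] e0 e2.
have [||_ /= m1 _ m0] := cross_corner b1 b1'; try by left; apply: e0.
have [||/= m2 _ _ _] := cross_corner b3 b3'; try by right; apply: e2.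
by case=> [|[|[|]]].
Qed.

Lemma triangle_r_rigid v01 v02 v12 o0 o1 o2 :
  rigid S tau (triangle_r v01 v02 v12 o0 o1 o2).
Proof.
apply: threads_rigid => b b' /and4P[b1 _ b3 _] /and4P[b1' _ b3' _] e0 e2.
have [||_ /= m2 _ m1] := cross_corner b1 b1'; try by left; apply: e0.
have [||_ _ /= m0 _] := cross_corner b3 b3'; try by right; apply: e2.
by case=> [|[|[|]]].
Qed.

Lemma clasp_rigid v o0 o1 : rigid S tau (clasp v o0 o1).
Proof.
apply: threads_rigid => b b' /and3P[b1 _ _] /and3P[b1' _ _] e0 _.
have [||_ /= m1 _ m0] := cross_corner b1 b1'; try by left; apply: e0.
by case=> [|[|]].
Qed.

Lemma curl_rigid v side : rigid S tau (curl v side).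
Proof.
apply: threads_rigid => b b' /andP[b1 _] /andP[b1' _] e0 e2 [|//] _.
case: side b1 b1' => b1 b1'.
  have [||_ /= m0 _ _ //] := cross_corner (op := true) (oq := true) b1 b1'.
    by left; apply: e0.
  by right; apply: e2.
have [||/= m0 _ _ _ //] := cross_corner (op := true) (oq := true) b1 b1'.
  by right; apply: e2.
by left; apply: e0.
Qed.

Lemma straight_rigid n : rigid S tau (straight n).
Proof. by move=> b b' _ _ bb' i; apply: (bb' (i, true)). Qed.

Lemma two_crossings_rigid k k' : k != Neg -> rigid S tau (two_crossings k k').
Proof.
move=> k_pos; apply: threads_rigid => b b' /and3P[b1 _ _] /and3P[b1' _ _] e0 _.
by case: k k_pos b1 b1' => //= _; rewrite !e0 => /eqP U /eqP;
  rewrite -{}U => -[m1 m0]; case=> [|[|]].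
Qed.

(** * Curls, clasps and the exchange of a positive and a singular crossing *)

(** For the reference directions the two starting arcs lie on a common sector,
    so that their colors can be prescribed. *)
Lemma cross_fill v op oq x y : exists x' y',
  legal S tau id (cross v op (x, x') oq (y, y')).
Proof.
have fill T (z t : X) : square_map T ->
  [/\ exists p q, (p, q) == T (z, t), exists p q, (z, t) == T (p, q),
       exists q y, (z, q) == T (t, y) & exists p x, (p, z) == T (x, t)].
  move=> sq; split.
  - by exists (T (z, t)).1, (T (z, t)).2; rewrite -surjective_pairing.
  - by have [a [b E]] := square_out z t sq; exists a, b; rewrite E.
  - by have [b [q E]] := square_left t z sq; exists q, b; rewrite E.
  - by have [a [p E]] := square_right t z sq; exists p, a; rewrite E.
have fS z t := fill S z t sqS; have fT z t := fill tau z t sqT.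
have swap (P : X -> X -> bool) : (exists a b, P a b) -> exists b a, P a b.
  by case=> a [b]; exists b, a.
by case: v op oq => [] [] []; rewrite /cross /=;
  case: (fS x y) => *; case: (fS y x) => *;
  case: (fT x y) => *; case: (fT y x) => *; first [assumption | apply: swap].
Qed.

(** The second crossing of a clasp is the mirror image of the first one,
    travelled backwards: it imposes the same relation, with the opposite
    weight. *)
Lemma cross_cancel E (c : E -> X) over op oq (p q : E * E) :
  legal S tau c (cross (classical over) op (p.2, p.1) oq (q.2, q.1))
    = legal S tau c (cross (swap_level (classical over)) oq q op p)
  /\
  weight f h c (cross (swap_level (classical over)) oq q op p)
    + weight f h c (cross (classical over) op (p.2, p.1) oq (q.2, q.1)) = 0.
Proof.
by case: over op oq => [] [] []; rewrite /= ?addrN ?addNr.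
Qed.

Lemma legal_cross E (c : E -> X) v op oq (p q : E * E) :
  legal S tau c (cross v op p oq q)
    = legal S tau id (cross v op (c p.1, c p.2) oq (c q.1, c q.2)).
Proof. by case: v op oq => [] [] []. Qed.

Lemma weight_cross E (c : E -> X) v op oq (p q : E * E) :
  weight f h c (cross v op p oq q)
    = weight f h id (cross v op (c p.1, c p.2) oq (c q.1, c q.2)).
Proof. by case: v op oq => [] [] []. Qed.

Lemma straight_transfers n xs :
  (forall b : 'I_n.+1 -> X, exists m,
     let c := recolor (fun e => b e.1) m in
     proper S tau c xs /\ total f h c xs = 0) ->
  transfers S tau f h (straight n.+1) (threads xs).
Proof.
move=> fill b _; have [m [cP c0]] := fill b.
exists (recolor (fun e => b e.1) m).
  move=> [i []] /=; rewrite -(inord_val i); first by rewrite recolor_end.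
  by rewrite recolor_start.
by rewrite c0 /total big_nil.
Qed.

Lemma transfers_straight n xs :
  (forall b, proper S tau b xs ->
     (forall i, (i < n.+1)%N -> b (inord i, inord 0) = b (inord i, inord 2))
     /\ total f h b xs = 0) ->
  transfers S tau f h (threads xs) (straight n.+1).
Proof.
move=> loop b /loop[b02 b0]; exists (fun i => b (i, inord 0)).
  by move=> [i []] //=; rewrite -(inord_val i) b02.
by split=> //; rewrite b0 /total big_nil.
Qed.

Lemma straight_clasp over o0 o1 :
  transfers S tau f h (straight 2) (clasp (classical over) o0 o1).
Proof.
apply: straight_transfers => b.
have [y1 [x1 leg]] :=
  cross_fill (swap_level (classical over)) o1 o0 (b (inord 1)) (b (inord 0)).
have [leg2 w0] :=
  cross_cancel id over o0 o1 (b (inord 0), x1) (b (inord 1), y1).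
exists [:: x1; y1]; rewrite /proper /total /= big_cons big_seq1.
rewrite !(legal_cross (recolor _ _)) !(weight_cross (recolor _ _)).
by rewrite !(recolor_start, recolor_end, recolor_mid) //= leg2 leg.
Qed.

Lemma clasp_straight over o0 o1 :
  transfers S tau f h (clasp (classical over) o0 o1) (straight 2).
Proof.
apply: transfers_straight => b /and3P[b1 b2 _].
have [leg w0] := cross_cancel b over o0 o1 (pass 1 0 0) (pass 1 1 0).
rewrite b1 in leg.
have [||_ /= e0 _ e1] := cross_corner leg b2; try by left.
split; first by case=> [|[|]].
rewrite /total big_cons big_seq1 -[RHS]w0; congr (_ + _).
by rewrite !(weight_cross b) /= e0 e1.
Qed.

(** The arc of the curl gets the color that makes the pair read at the crossing
    a fixed point of [S]; it comes first in that pair when [side] is true. *)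
Lemma straight_curl over side :
  transfers S tau f h (straight 1) (curl (classical over) side).
Proof.
have [[s' sK s'K] fixP] := fix_s; have [_ f0 _ _ _] := coc.
apply: straight_transfers => b; pose x := b (inord 0).
have fx y : S (y, s y) = (y, s y) by apply/fixP.
have fx' : S (s' x, x) = (s' x, x) by rewrite -{2 4}(s'K x).
have f0' : f (s' x, x) = 0 by rewrite -{2}(s'K x).
exists [:: if side then s' x else s x]; rewrite /proper /total.
by case: side over => [] [];
  rewrite /= big_seq1 /= !(recolor_start, recolor_end, recolor_mid) //= -/x;
  rewrite ?fx ?fx' ?f0 ?f0' ?oppr0 ?eqxx.
Qed.

(** The arc of the curl occurs twice at its crossing, at the same position in a
    pair and in its image by [S].  Such a square shares a lateral corner with
    the square of a fixed point ([leftP], [rightP]), hence coincides with it. *)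
Lemma curl_straight over side :
  transfers S tau f h (curl (classical over) side) (straight 1).
Proof.
have [[s' sK s'K] fixP] := fix_s; have [_ f0 _ _ _] := coc.
have fx y : S (y, s y) = (y, s y) by apply/fixP.
have leftP x y z : S (x, y) = (x, z) -> y = z /\ f (x, y) = 0.
  move=> E; have [] := square_corner sqS E (fx x); first by constructor 3.
  by move=> _ -> _ ->.
have rightP x y z : S (x, y) = (z, y) -> x = z /\ f (x, y) = 0.
  move=> E; have:= fx (s' y); rewrite s'K => E'.
  have [] := square_corner sqS E E'; first by constructor 4.
  by move=> -> _ -> _; split=> //; rewrite -{2}(s'K y).
apply: transfers_straight => b /andP[b1 _].
by case: side over b1 => [] [] /eqP/esym b1; rewrite /total big_seq1 /=;
  (case: (leftP _ _ _ b1) || case: (rightP _ _ _ b1)) => e0 ->;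
  rewrite ?oppr0; split=> // -[].
Qed.

Lemma Pos_Sing_transfers :
  transfers S tau f h (two_crossings Pos Sing) (two_crossings Sing Pos).
Proof.
have [_ _ comm _ _] := sing; have [_ _ _ _ c3] := coc.
apply: threads_transfers => b /and3P[/eqP e1 /eqP e2 _].
pose t := tau (b (inord 0, inord 0), b (inord 1, inord 0)).
(* strand 1 is on the left between the two crossings *)
exists [:: t.2; t.1]; rewrite /proper /total !big_cons !big_nil /=.
rewrite !(recolor_start, recolor_end, recolor_mid) //= -!surjective_pairing.
rewrite !addr0 e1 c3 eqxx -/t e2 e1 -[S t]/((S \o tau) _) -comm.
by rewrite /= eqxx.
Qed.

Lemma Sing_Pos_transfers :
  transfers S tau f h (two_crossings Sing Pos) (two_crossings Pos Sing).
Proof.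
have [_ _ comm _ _] := sing; have [_ _ _ _ c3] := coc.
apply: threads_transfers => b /and3P[/eqP e1 /eqP e2 _].
pose t := S (b (inord 0, inord 0), b (inord 1, inord 0)).
exists [:: t.2; t.1]; rewrite /proper /total !big_cons !big_nil /=.
rewrite !(recolor_start, recolor_end, recolor_mid) //= -!surjective_pairing.
rewrite !addr0 e1 -c3 eqxx -/t e2 e1 -[tau t]/((tau \o S) _) comm.
by rewrite /= eqxx.
Qed.

(** * Invariance *)

Lemma move_local_sum B (T T' : tangle B) : move T T' ->
  local_sum S tau f h T =2 local_sum S tau f h T'.
Proof.
case=> [over side | over o0 o1 | b01 b02 b12 o0 o1 o2 lv | o0 o1 o2
       | o0 o1 o2 |].
- apply: local_sum_eq; [exact: straight_rigid | exact: curl_rigid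
    | exact: straight_curl | exact: curl_straight].
- apply: local_sum_eq; [exact: straight_rigid | exact: clasp_rigid
    | exact: straight_clasp | exact: clasp_straight].
- have [lr rl] := RIII_transfers o0 o1 o2 lv.
  by apply: local_sum_eq; [exact: triangle_l_rigid | exact: triangle_r_rigid
    | exact: lr | exact: rl].
- have [lr rl] := RIV_transfers true o0 o1 o2.
  by apply: local_sum_eq; [exact: triangle_l_rigid | exact: triangle_r_rigid
    | exact: lr | exact: rl].
- have [lr rl] := RIV_transfers false o0 o1 o2.
  by apply: local_sum_eq; [exact: triangle_l_rigid | exact: triangle_r_rigid
    | exact: lr | exact: rl].
- apply: local_sum_eq; [exact: two_crossings_rigid | exact: two_crossings_rigid
    | exact: Pos_Sing_transfers | exact: Sing_Pos_transfers].
Qed.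

Lemma state_sum_elementary D D' : elementary D D' ->
  state_sum S tau f h D = state_sum S tau f h D'.
Proof.
case=> [|[B [K [T [T' [TT' DK DK']]]]]]; first exact: state_sum_isotopic.
rewrite (state_sum_glued _ _ _ _ DK) (state_sum_glued _ _ _ _ DK').
by apply: eq_bigr => a _; apply: move_local_sum.
Qed.

End Moves.

Theorem theorem45 (X : finType) (S tau : X * X -> X * X) (s : X -> X)
  (H : zmodType) (f h : X * X -> H) :
  singular_pair S tau ->
  fixed_point_map S s ->
  cocycle_pair S tau s f h ->
  forall L L' : diagram,
    singular_link_equiv L L' ->
    state_sum S tau f h L = state_sum S tau f h L'.
Proof.
move=> sing fix_s coc L L'.
elim=> {L L'} [L L' | // | L L' _ -> // | L L' L'' _ -> _ -> //].
exact: state_sum_elementary sing fix_s coc L L'.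
Qed.
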